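(* Let $\mathcal N$ be a sinkless rotor network on a finite strongly connected digraph $G=(V,E)$. Let $(y_e)_{e\in E}$ and $(z_v)_{v\in V}$ be indeterminates. Let $A_G(y)$ be the $V\times V$ matrix whose $(u,v)$ entry is $\sum_e y_e$, summed over all edges $e$ with source $v$ and target $u$, and let $D_G(y,z)$ be the diagonal $V\times V$ matrix with $D_G(y,z)(v,v)=\frac{1}{1-z_v}\sum_{e\in\mathrm{Out}(v)}y_e$, where $\mathrm{Out}(v)$ is the set of edges with source $v$. Then, in the ring $\mathbb Z[y][[z]]$ of formal power series in the $z_v$ with coefficients polynomial in the $y_e$, $$\det\bigl(D_G(y,z)-A_G(y)\bigr)=\sum_{\mathbf x.\mathbf q\in\mathrm{Rec}(\mathcal N)}z^{\mathbf x}\,y_{\mathbf q},$$ where $z^{\mathbf x}=\prod_v z_v^{\mathbf x(v)}$, $y_{\mathbf q}=\prod_{v\in V}y_{\mathbf q(v)}$, and $\mathrm{Rec}(\mathcal N)$ is the set of recurrent configurations of $\mathcal N$.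
   Context: $G$ may have multiple edges and self-loops. Sinkless rotor network: for each $v\in V$ fix a cyclic order $e^v_0,\dots,e^v_{d-1}$ ($d=\mathrm{outdeg}(v)$, indices mod $d$) on the outgoing edges of $v$. A configuration is a pair $\mathbf x.\mathbf q$ with $\mathbf x\in\mathbb Z^V$ (chips) and $\mathbf q:V\to E$ with $\mathbf q(v)\in\mathrm{Out}(v)$ (rotors). Legal move at a vertex $v$ with $\mathbf x(v)\ge1$: if $\mathbf q(v)=e^v_i$, change $\mathbf q(v)$ to $e^v_{i+1}$ and move one chip from $v$ to the target of $e^v_{i+1}$. Write $\mathbf x.\mathbf q\to\mathbf x'.\mathbf q'$ if there is a (possibly empty) finite sequence of legal moves from $\mathbf x.\mathbf q$ to $\mathbf x'.\mathbf q'$. A configuration $\mathbf x.\mathbf q$ is recurrent if (1) at least one legal move is possible from it; and (2) whenever $\mathbf x.\mathbf q\to\mathbf x''.\mathbf q''$ and $\mathbf x'.\mathbf q'\to\mathbf x''.\mathbf q''$ for some configurations $\mathbf x'.\mathbf q'$, $\mathbf x''.\mathbf q''$, one has $\mathbf x'.\mathbf q'\to\mathbf x.\mathbf q$. (Recurrent configurations have $\mathbf x\in\mathbb N^V$.) *)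

(* Defs.v *)
From Stdlib Require Import Relation_Operators Operators_Properties.
From HB Require Import structures.
From mathcomp Require Import all_boot all_order all_algebra.
From mathcomp Require Import boolp classical_sets functions cardinality fsbigop.
From mathcomp Require Import mpoly.

Set Implicit Arguments.
Unset Strict Implicit.
Unset Printing Implicit Defensive.

Import Order.TTheory GRing.Theory Num.Theory.

Local Open Scope ring_scope.

Record fpseries (n : nat) (R : Type) := FPSeries { fpcoef : 'X_{1..n} -> R }.

Notation "{ 'fps' R [ n ] }" := (fpseries n R)
  (at level 0, R at level 2, n at level 2, format "{ 'fps'  R [ n ] }").

HB.instance Definition _ n R := gen_eqMixin {fps R[n]}.
HB.instance Definition _ n R := gen_choiceMixin {fps R[n]}.

Lemma fpsP n R (f g : {fps R[n]}) :
  (forall m, fpcoef f m = fpcoef g m) <-> f = g.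
Proof.
split=> [|-> //]; case: f g => [f] [g] /= fg.
by congr FPSeries; apply/funext.
Qed.

Section FPSZmodule.
Context (n : nat) (R : zmodType).
Implicit Types f g h : {fps R[n]}.

Definition fps_zero : {fps R[n]} := FPSeries (fun=> 0).
Definition fps_opp f : {fps R[n]} := FPSeries (fun m => - fpcoef f m).
Definition fps_add f g : {fps R[n]} :=
  FPSeries (fun m => fpcoef f m + fpcoef g m).

Fact fps_addA : associative fps_add.
Proof. by move=> f g h; apply/fpsP => m /=; rewrite addrA. Qed.

Fact fps_addC : commutative fps_add.
Proof. by move=> f g; apply/fpsP => m /=; rewrite addrC. Qed.

Fact fps_add0 : left_id fps_zero fps_add.
Proof. by move=> f; apply/fpsP => m /=; rewrite add0r. Qed.

Fact fps_addN : left_inverse fps_zero fps_opp fps_add.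
Proof. by move=> f; apply/fpsP => m /=; rewrite addNr. Qed.

HB.instance Definition _ := GRing.isZmodule.Build {fps R[n]}
  fps_addA fps_addC fps_add0 fps_addN.

Lemma fpcoef0 m : fpcoef (0 : {fps R[n]}) m = 0. Proof. by []. Qed.
Lemma fpcoefN f m : fpcoef (- f) m = - fpcoef f m. Proof. by []. Qed.
Lemma fpcoefD f g m : fpcoef (f + g) m = fpcoef f m + fpcoef g m.
Proof. by []. Qed.
Lemma fpcoefB f g m : fpcoef (f - g) m = fpcoef f m - fpcoef g m.
Proof. by []. Qed.

End FPSZmodule.

Section FPSRing.
Context (n : nat) (R : comNzRingType).
Implicit Types f g h : {fps R[n]}.

Definition fps_const (c : R) : {fps R[n]} :=
  FPSeries (fun m => if m == 0%MM then c else 0).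

Definition fps_mul f g : {fps R[n]} :=
  FPSeries (fun m => \sum_(k : 'X_{1..n < (mdeg m).+1} | (k <= m)%MM)
                       fpcoef f k * fpcoef g (m - k)%MM).

(* The ring laws are inherited from those of [{mpoly R[n]}] by truncation. *)
Definition fps_trunc d f : {mpoly R[n]} :=
  \sum_(m : 'X_{1..n < d}) fpcoef f m *: 'X_[m].

Lemma mcoeff_trunc d f m : (mdeg m < d)%N -> (fps_trunc d f)@_m = fpcoef f m.
Proof. exact: mcoeff_mpoly. Qed.

Lemma fpcoef_mul_mpoly f g (p q : {mpoly R[n]}) m :
    (forall k, (mdeg k <= mdeg m)%N -> p@_k = fpcoef f k) ->
    (forall k, (mdeg k <= mdeg m)%N -> q@_k = fpcoef g k) ->
  fpcoef (fps_mul f g) m = (p * q)@_m.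
Proof.
move=> pf qg; rewrite [RHS](@mcoeff_poly_mul_lin _ _ p q m _ (ltnSn _)) /=.
apply: eq_bigr => k le_km; rewrite pf; last by rewrite -ltnS bmdeg.
by rewrite qg// mdegB.
Qed.

Lemma fpcoef_mul_trunc f g m d : (mdeg m < d)%N ->
  fpcoef (fps_mul f g) m = (fps_trunc d f * fps_trunc d g)@_m.
Proof.
by move=> md; apply: fpcoef_mul_mpoly => k km;
  rewrite mcoeff_trunc// (leq_ltn_trans km).
Qed.

Fact fps_mulA : associative fps_mul.
Proof.
move=> f g h; apply/fpsP => m; have md := ltnSn (mdeg m).
rewrite (@fpcoef_mul_mpoly f _ (fps_trunc (mdeg m).+1 f)
  (fps_trunc (mdeg m).+1 g * fps_trunc (mdeg m).+1 h)); last 2 first.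
- by move=> k km; rewrite mcoeff_trunc.
- by move=> k km; rewrite (@fpcoef_mul_trunc _ _ _ (mdeg m).+1).
rewrite (@fpcoef_mul_mpoly _ h
  (fps_trunc (mdeg m).+1 f * fps_trunc (mdeg m).+1 g)
  (fps_trunc (mdeg m).+1 h)) ?mulrA//.
- by move=> k km; rewrite (@fpcoef_mul_trunc _ _ _ (mdeg m).+1).
- by move=> k km; rewrite mcoeff_trunc.
Qed.

Fact fps_mulC : commutative fps_mul.
Proof.
move=> f g; apply/fpsP => m.
by rewrite !(@fpcoef_mul_trunc _ _ _ (mdeg m).+1)// mulrC.
Qed.

Fact fps_mul1 : left_id (fps_const 1) fps_mul.
Proof.
move=> f; apply/fpsP => m.
rewrite (@fpcoef_mul_mpoly _ _ 1 (fps_trunc (mdeg m).+1 f)).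
- by rewrite mul1r mcoeff_trunc.
- by move=> k _; rewrite mcoeff1 /=; case: eqP.
- by move=> k km; rewrite mcoeff_trunc.
Qed.

Fact fps_mulDl : left_distributive fps_mul +%R.
Proof.
move=> f g h; apply/fpsP => m; rewrite fpcoefD /= -big_split /=.
by apply: eq_bigr => k _; rewrite mulrDl.
Qed.

Fact fps_oner_neq0 : fps_const 1 != 0.
Proof.
by apply/eqP => /(congr1 (fun f : {fps R[n]} => fpcoef f 0%MM)) /= /eqP;
  rewrite eqxx oner_eq0.
Qed.

HB.instance Definition _ := GRing.Zmodule_isComNzRing.Build {fps R[n]}
  fps_mulA fps_mulC fps_mul1 fps_mulDl fps_oner_neq0.

Lemma fpcoefM f g m : fpcoef (f * g) m =
  \sum_(k : 'X_{1..n < (mdeg m).+1} | (k <= m)%MM)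
    fpcoef f k * fpcoef g (m - k)%MM.
Proof. by []. Qed.

Lemma fpcoefC c m : fpcoef (fps_const c) m = if m == 0%MM then c else 0.
Proof. by []. Qed.

Lemma fpcoef1 m : fpcoef (1 : {fps R[n]}) m = (m == 0%MM)%:R.
Proof. by rewrite fpcoefC; case: eqP. Qed.

Definition fps_unit : pred {fps R[n]} := fun f => `[< exists g, g * f = 1 >].

Definition fps_inv f : {fps R[n]} :=
  if pselect (exists g, g * f = 1) is left ex_g then projT1 (cid ex_g) else f.

Fact fps_mulVr : {in fps_unit, left_inverse 1 fps_inv *%R}.
Proof.
move=> f; rewrite unfold_in => /asboolP ex_g.
by rewrite /fps_inv; case: pselect => // ex_g'; case: cid.
Qed.

Fact fps_unitP f g : g * f = 1 -> fps_unit f.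
Proof. by move=> gf; apply/asboolP; exists g. Qed.

Fact fps_inv_out : {in [predC fps_unit], fps_inv =1 id}.
Proof.
move=> f; rewrite inE /= unfold_in => /asboolP nex.
by rewrite /fps_inv; case: pselect.
Qed.

HB.instance Definition _ := GRing.ComNzRing_hasMulInverse.Build {fps R[n]}
  fps_mulVr fps_unitP fps_inv_out.

Definition fps_var (i : 'I_n) : {fps R[n]} :=
  FPSeries (fun m => (m == U_(i)%MM)%:R).

Lemma fpcoef_varM i f m : fpcoef (fps_var i * f) m =
  if (U_(i) <= m)%MM then fpcoef f (m - U_(i))%MM else 0.
Proof.
rewrite fpcoefM; case: ifPn => [le_im|nle_im].
  have lt_i : (mdeg (U_(i)%MM : 'X_{1..n}) < (mdeg m).+1)%N.
    by rewrite ltnS -(submK le_im) mdegD leq_addl.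
  rewrite (bigD1 (BMultinom lt_i)) //= eqxx mul1r big1 ?addr0// => k.
  by case/andP=> _; rewrite -val_eqE /= => /negPf ->; rewrite mul0r.
apply: big1 => k le_km /=; case: eqP => [ki|]; last by rewrite mul0r.
by rewrite -ki le_km in nle_im.
Qed.

Lemma fps_geometric i :
  (1 - fps_var i) * FPSeries (fun m => (m == U_(i) *+ m i)%MM%:R) = 1.
Proof.
apply/fpsP => m; rewrite mulrBl mul1r fpcoefB fpcoef_varM fpcoef1 /=.
case: ifPn => [le_im|nle_im].
  have mi0 : (0 < m i)%N by move/mnm_lepP: le_im => /(_ i); rewrite mnm1E eqxx.
  have -> : (m == 0%MM) = false.
    by apply/eqP => m0; rewrite m0 mnm0E in mi0.
  have -> : (U_(i) *+ m i)%MM = (U_(i) *+ (m - U_(i))%MM i + U_(i))%MM.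
    by rewrite mnmBE mnm1E eqxx addmC -mulmS subn1 prednK.
  by rewrite -{1}(submK le_im) eqm_add2r subrr.
rewrite subr0; have -> : m i = 0%N.
  apply/eqP; rewrite -leqn0 leqNgt; apply: contra nle_im => mi.
  by apply/mnm_lepP => j; rewrite mnm1E; case: eqP => [<-|].
by rewrite mulm0n.
Qed.

Lemma fps_unit_1subX i : (1 - fps_var i) \is a GRing.unit.
Proof. by apply/unitrPr; eexists; exact: fps_geometric. Qed.

Lemma fpcoef_geometric i m :
  fpcoef (1 - fps_var i)^-1 m = (m == U_(i) *+ m i)%MM%:R.
Proof.
suff -> : (1 - fps_var i)^-1 = FPSeries (fun m => (m == U_(i) *+ m i)%MM%:R) by [].
apply: (mulrI (fps_unit_1subX i)).
by rewrite mulrV ?fps_unit_1subX// fps_geometric.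
Qed.

End FPSRing.

Arguments fps_const {n R} c.
Arguments fps_var {n R} i.

(* [S] is the formal sum of the family [F] over [A]: for each monomial, only
   finitely many members of the family have a nonzero coefficient, and these
   coefficients add up to that of [S]. *)
Definition fps_has_sum n (R : comNzRingType) (I : choiceType) (A : set I)
    (F : I -> {fps R[n]}) (S : {fps R[n]}) : Prop :=
  forall m : 'X_{1..n},
    finite_set [set i | A i /\ fpcoef (F i) m != 0] /\
    fpcoef S m = \sum_(i \in A) fpcoef (F i) m.

Record digraph (V E : finType) := Digraph {
  source : E -> V;
  target : E -> V
}.

Section Digraph.
Context (V E : finType) (G : digraph V E).

Definition Out (v : V) : {set E} := [set e | source G e == v].

Definition adjacent : rel V :=
  [rel u v | [exists e, (source G e == u) && (target G e == v)]].

Definition strongly_connected : Prop := forall u v : V, connect adjacent u v.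

Definition sinkless : Prop := forall v : V, (0 < #|Out v|)%N.

(* [rotor_order v] lists the edges [e^v_0, ..., e^v_{d-1}] leaving [v]; it is
   read cyclically through [next]. *)
Record rotor_network := RotorNetwork {
  rotor_order : V -> seq E;
  rotor_order_uniq : forall v, uniq (rotor_order v);
  mem_rotor_order : forall v, rotor_order v =i Out v
}.

Definition config : Type :=
  {c : {ffun V -> int} * {ffun V -> E} | [forall v, c.2 v \in Out v]}.

HB.instance Definition _ := Choice.on config.

Definition chips (c : config) : {ffun V -> int} := (sval c).1.
Definition rotor (c : config) : {ffun V -> E} := (sval c).2.

Lemma rotorP c v : rotor c v \in Out v.
Proof. exact: (forallP (valP c) v). Qed.

Context (N : rotor_network).

Definition next_rotor (c : config) (v : V) : E :=
  next (rotor_order N v) (rotor c v).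

Definition legal_move_at (v : V) (c c' : config) : Prop :=
  [/\ 1 <= chips c v,
      rotor c' = [ffun w => if w == v then next_rotor c v else rotor c w]
    & chips c' = [ffun w => chips c w - (w == v)%:R
                              + (w == target G (next_rotor c v))%:R]].

Definition legal_move (c c' : config) : Prop :=
  exists v, legal_move_at v c c'.

Definition legal_reach : config -> config -> Prop :=
  clos_refl_trans config legal_move.

Definition recurrent : set config := [set c |
  (exists c', legal_move c c') /\
  (forall c' c'', legal_reach c c'' -> legal_reach c' c'' ->
    legal_reach c' c)].

Lemma legal_move_at_ex v c : 1 <= chips c v -> exists c', legal_move_at v c c'.
Proof.
move=> cv.
have okP : [forall w, [ffun w => if w == v then next_rotor c v
    else rotor c w] w \in Out w].
  apply/forallP => w; rewrite ffunE; case: eqP => [->|_]; last exact: rotorP.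
  by rewrite -(mem_rotor_order N) mem_next mem_rotor_order rotorP.
by exists (exist _ ([ffun w => chips c w - (w == v)%:R
  + (w == target G (next_rotor c v))%:R],
  [ffun w => if w == v then next_rotor c v else rotor c w]) okP).
Qed.

Lemma legal_reach_move c c' c'' :
  legal_move c c' -> legal_reach c' c'' -> legal_reach c c''.
Proof. by move=> m; apply: rt_trans; apply: rt_step. Qed.

Lemma legal_reach_ind (P : config -> config -> Prop) :
    (forall c, P c c) ->
    (forall c c' c'', legal_move c c' -> legal_reach c' c'' -> P c' c'' ->
      P c c'') ->
  forall c c', legal_reach c c' -> P c c'.
Proof.
move=> P0 PS c c' cc'; have {cc'} := @clos_rt_rt1n _ _ _ _ cc'.
elim=> {c c'} [//|c c1 c' m r]; apply: PS => //.
exact: clos_rt1n_rt.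
Qed.

Lemma chips_ge0_reach v c c' :
  legal_reach c c' -> 0 <= chips c v -> 0 <= chips c' v.
Proof.
move: c c'; apply: legal_reach_ind => // c c1 c' [w [cw _ chE]] _ IH cv.
apply: IH; rewrite chE ffunE addr_ge0 ?ler0n// subr_ge0.
by case: eqP => [->|].
Qed.

Lemma chips_le_reach v c c' : legal_reach c c' ->
  (forall d, legal_reach c d -> ~ 1 <= chips d v) -> chips c v <= chips c' v.
Proof.
move: c c'; apply: legal_reach_ind => // c c1 c' m r IH nv.
apply: (@le_trans _ _ (chips c1 v)); last first.
  by apply: IH => d rd; apply: nv; apply: legal_reach_move rd.
case: m => w [cw _ ->]; rewrite ffunE.
case: eqP cw => [<- /(nv _ (rt_refl _ _ _))//|_ _].
by rewrite subr0 lerDl ler0n.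
Qed.

Lemma firable_same_rotor v c c' : legal_reach c c' -> 1 <= chips c' v ->
  exists d, [/\ legal_reach c d, 1 <= chips d v & rotor d v = rotor c v].
Proof.
move: c c'; apply: legal_reach_ind => [c cv|c c1 c' m r IH c'v].
  by exists c; split=> //; apply: rt_refl.
have [d [rd dv dE]] := IH c'v.
case: (m) => w [cw rE _]; have [vw|vw] := eqVneq v w.
  by exists c; rewrite vw; split=> //; apply: rt_refl.
exists d; split=> //; first exact: legal_reach_move rd.
by rewrite dE rE ffunE (negPf vw).
Qed.

Lemma recurrent_fires c : strongly_connected -> recurrent c ->
  forall v, exists d, legal_reach c d /\ 1 <= chips d v.
Proof.
move=> Gsc [[c1 [v0 [cv0 _ _]]] crec] v.
have back d : legal_reach c d -> legal_reach d c.
  by move=> cd; apply: crec cd _; apply: rt_refl.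
have anyrotor u e : e \in Out u ->
    (exists d, legal_reach c d /\ 1 <= chips d u) ->
    exists d, [/\ legal_reach c d, 1 <= chips d u & rotor d u = e].
  move=> eu [d [cd du]].
  have iterP k : exists d', [/\ legal_reach c d', 1 <= chips d' u
      & rotor d' u = iter k (next (rotor_order N u)) (rotor d u)].
    elim: k => [|k [d' [cd' d'u d'E]]]; first by exists d.
    have [d2 m] := legal_move_at_ex d'u.
    have cd2 : legal_reach c d2.
      by apply: rt_trans cd' _; apply: rt_step; exists u.
    have [d3 [d23 d3u d3E]] :=
      firable_same_rotor (rt_trans _ _ _ _ _ (back _ cd2) cd) du.
    exists d3; split=> //; first exact: rt_trans cd2 d23.
    by case: m => _ rE _; rewrite d3E rE ffunE eqxx /next_rotor d'E.
  have : fconnect (next (rotor_order N u)) (rotor d u) e.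
    rewrite (fconnect_cycle (cycle_next (rotor_order_uniq N u))).
      by rewrite mem_rotor_order.
    by rewrite mem_rotor_order rotorP.
  by move/iter_findex => <-.
have step u w : adjacent u w ->
    (exists d, legal_reach c d /\ 1 <= chips d u) ->
    exists d, legal_reach c d /\ 1 <= chips d w.
  move=> /existsP[e /andP[eu /eqP ew]] uF.
  have [wu|wu] := eqVneq w u; first by rewrite wu.
  have eOut : prev (rotor_order N u) e \in Out u.
    by rewrite -(mem_rotor_order N) mem_prev mem_rotor_order inE.
  have [d [cd du dE]] := anyrotor _ _ eOut uF.
  have [d' m] := legal_move_at_ex du.
  have cd' : legal_reach c d'.
    by apply: rt_trans cd _; apply: rt_step; exists u.
  apply: contrapT => nF.
  have := chips_le_reach (v := w) (rt_trans _ _ _ _ _ (back _ cd') cd).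
  case: m => _ _ ->; rewrite ffunE (negPf wu) subr0 /next_rotor dE.
  rewrite next_prev ?rotor_order_uniq// ew eqxx gerDl ler10 => H.
  have // : false; apply: H => d2 d'2 d2w; apply: nF; exists d2.
  by split=> //; apply: rt_trans cd' d'2.
have /connectP[p + ->] := Gsc v0 v.
have : exists d, legal_reach c d /\ 1 <= chips d v0.
  by exists c; split=> //; apply: rt_refl.
by elim: p v0 {cv0} => //= w p IH u uF /andP[/step/(_ uF)]; apply: IH.
Qed.

Lemma recurrent_chips_ge0 c v :
  strongly_connected -> recurrent c -> 0 <= chips c v.
Proof.
move=> Gsc crec; have [d [cd dv]] := recurrent_fires Gsc crec v.
apply: (@chips_ge0_reach v d); last exact: le_trans dv.
by case: crec => _; apply; [exact: cd|apply: rt_refl].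
Qed.

End Digraph.

Section Matrices.
Context (V E : finType).

Local Notation Zyz := {fps {mpoly int[#|E|]}[#|V|]}.

Definition yvar (e : E) : Zyz := fps_const 'X_(enum_rank e).
Definition zvar (v : V) : Zyz := fps_var (enum_rank v).

Context (G : digraph V E).

Definition A_mx : 'M[Zyz]_#|V| :=
  \matrix_(i, j) \sum_(e | (source G e == enum_val j) &&
                           (target G e == enum_val i)) yvar e.

Definition D_mx : 'M[Zyz]_#|V| :=
  diag_mx (\row_i ((1 - zvar (enum_val i))^-1 *
                   \sum_(e in Out G (enum_val i)) yvar e)).

(* [chips c v] is an [int]; by [recurrent_chips_ge0] no negative power of an
   indeterminate occurs when [c] is recurrent. *)
Definition zpow (c : config G) : Zyz := \prod_(v : V) zvar v ^ chips c v.
Definition yrotor (c : config G) : Zyz := \prod_(v : V) yvar (rotor c v).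

End Matrices.

(* Main.v *)
(* Recurrent configurations are those with nonnegative chips in which every
   directed cycle formed by the rotors carries a chip.
   - Necessity: a recurrent configuration is revisited after every vertex has
     fired, and the vertex of a rotor cycle that fires last leaves its chip on
     that cycle.
   - Sufficiency: strong connectivity yields positive numbers of full rotor
     turns whose net effect, legality aside, is the identity. If the execution
     of the prescribed firings gets stuck, the vertices with firings left are
     empty, and in the final configuration they are still empty and have their
     rotors pointing at one another, so they contain an empty rotor cycle.
     Hence every legal move out of such a configuration can be undone.

   On the determinant side, column [v] of [D - A] is a sum over the rotors
   [e] at [v] of [y_e] times a column of series in [z_v] only. So the
   coefficient of [z^m] is the sum over rotor choices [q] of [y_q] times the
   determinant of [1 - P], where [P] is the matrix of the functional digraph
   of [q] with the columns in the support of [m] erased. This determinant is 1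
   if every orbit of the functional digraph meets the support of [m], and 0
   otherwise. *)
From Stdlib Require Import Relation_Operators.
From mathcomp Require Import boolp classical_sets functions cardinality fsbigop.
Require Import Defs.
From mathcomp Require Import all_boot all_order fingroup perm all_algebra.
From mathcomp Require Import ring.
From mathcomp Require Import mpoly.

Set Implicit Arguments.
Unset Strict Implicit.
Unset Printing Implicit Defensive.

Import Order.TTheory GRing.Theory Num.Theory.

Local Open Scope ring_scope.

(** * Dynamics *)

Section Dynamics.
Context (V E : finType) (G : digraph V E) (N : rotor_network G).
Implicit Types c d : config G.

Definition rotor_succ c (v : V) : V := target G (rotor c v).

(* Every forward orbit of the rotors contains a chip; equivalently, every
   cycle of the rotors does. *)
Definition cycles_occupied c : Prop :=
  (forall v, 0 <= chips c v) /\
  (forall v, exists k, 1 <= chips c (iter k (rotor_succ c) v)).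

Lemma config_inj c d : chips c = chips d -> rotor c = rotor d -> c = d.
Proof.
case: c d => [[x q] qP] [[x' q'] q'P]; rewrite /chips /rotor /= => xE qE.
by apply/val_inj; rewrite /= xE qE.
Qed.

(* If [C] is visited at all, the last vertex of [C] to be visited sends its
   chip along its final rotor, hence to a vertex of [C] not visited anymore. *)
Lemma reach_closed_set (C : V -> Prop) d c :
    legal_reach N d c -> (forall u, C u -> C (rotor_succ c u)) ->
    (forall u, C u -> 0 <= chips d u) ->
  (forall u, C u -> rotor d u = rotor c u /\ chips d u <= chips c u) \/
  (exists2 u, C u & 1 <= chips c u).
Proof.
move: d c; apply: legal_reach_ind => [d _ _|d d1 c m r IH Cc d0]; first by left.
case: m => w m; case: (m) => dw rE chE.
have d10 u : C u -> 0 <= chips d1 u.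
  move=> Cu; apply: (@chips_ge0_reach _ _ _ N u d); last exact: d0.
  by apply: rt_step; exists w.
case: (IH Cc d10) => [same|]; last by right.
have [Cw|nCw] := pselect (C w); last first.
  left=> u Cu; have uw : u != w by apply: contra_notN nCw => /eqP uw; rewrite -uw.
  have [<- le_u] := same u Cu; rewrite rE ffunE (negPf uw); split=> //.
  by apply: le_trans le_u; rewrite chE ffunE (negPf uw) subr0 lerDl ler0n.
right; exists (rotor_succ c w); first exact: Cc.
have [rw _] := same w Cw; have [_] := same _ (Cc w Cw); apply: le_trans.
have succw : target G (next_rotor N d w) = rotor_succ c w.
  by rewrite /rotor_succ -rw rE ffunE eqxx.
rewrite chE ffunE succw eqxx mulr1n lerDr subr_ge0.
by case: eqP => [->|_] //; apply: d0 (Cc w Cw).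
Qed.

Lemma recurrent_cycles_occupied c :
  strongly_connected G -> recurrent N c -> cycles_occupied c.
Proof.
move=> Gsc crec; split=> [v|v]; first exact: recurrent_chips_ge0 crec.
have [d [cd dv]] := recurrent_fires Gsc crec v.
have dc : legal_reach N d c by case: crec => _; apply; [exact: cd|apply: rt_refl].
(* On the way back from [d], which has a chip at [v], either no vertex of the orbit [C] loses chips
   or [c] has a chip on [C]. *)
pose C u := exists k, u = iter k (rotor_succ c) v.
have Cc u : C u -> C (rotor_succ c u) by move=> [k ->]; exists k.+1.
case: (reach_closed_set dc Cc) => [u _|same|[_ [k ->] ck]].
- by apply: chips_ge0_reach cd _; exact: recurrent_chips_ge0 crec.
- by exists 0; apply: le_trans dv _; case: (same v) => //; exists 0.
- by exists k.
Qed.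

(** The fired vertex now points at the vertex that received its chip. All other rotors are
    unchanged, so an orbit either passes through the fired vertex or still reaches its old chip. *)
Lemma cycles_occupied_move c d :
  legal_move N c d -> cycles_occupied c -> cycles_occupied d.
Proof.
move=> m [c0 cc]; case: (m) => w [cw rE chE].
have succw : rotor_succ d w = target G (next_rotor N c w).
  by rewrite /rotor_succ rE ffunE eqxx.
have dw : 1 <= chips d (rotor_succ d w).
  rewrite chE ffunE succw eqxx mulr1n lerDr subr_ge0.
  by case: eqP => [->|_].
split=> [v|v]; first by apply: (@chips_ge0_reach _ _ _ N v c) => //; apply: rt_step.
have [k] := cc v; elim: k v => [|k IH] v /=; first move=> cv.
  have [->|vw] := eqVneq v w; first by exists 1.
  exists 0; apply: le_trans cv _.
  by rewrite chE ffunE (negPf vw) subr0 lerDl ler0n.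
rewrite -iterS iterSr => /IH[j dj].
have [->|vw] := eqVneq v w; first by exists 1.
exists j.+1; rewrite iterSr; suff -> : rotor_succ d v = rotor_succ c v by [].
by rewrite /rotor_succ rE ffunE (negPf vw).
Qed.

Lemma cycles_occupied_can_move c :
  (0 < #|V|)%N -> cycles_occupied c -> exists d, legal_move N c d.
Proof.
case/card_gt0P=> v _ [_ /(_ v)[k ck]].
by have [d m] := legal_move_at_ex N ck; exists d; eexists; exact: m.
Qed.

(** Counts the chips going from [u] to [v] in [n u] firings; the index [j.+1] reflects that the
    rotor turns before the chip moves. *)
Definition sent_to d (n : V -> nat) (u v : V) : nat :=
  \sum_(j < n u) (target G (iter j.+1 (next (rotor_order N u)) (rotor d u)) == v).

(* Firing each [v] exactly [n v] times, disregarding legality (in which case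
   the order is irrelevant), leads from [d] to [c]. *)
Definition fires_to d (n : V -> nat) c : Prop := forall v,
  rotor c v = iter (n v) (next (rotor_order N v)) (rotor d v) /\
  chips c v = chips d v - (n v)%:R + (\sum_u sent_to d n u v)%:R.

Lemma fires_to0 d n c : (forall v, n v = 0) -> fires_to d n c -> d = c.
Proof.
move=> n0 dc; apply: config_inj; apply/ffunP => v; have [rE chE] := dc v.
  rewrite chE n0 subr0 big1 ?addr0// => u _.
  by rewrite /sent_to n0 big_ord0.
by rewrite rE n0.
Qed.

Lemma fires_to_move d n c v d1 : fires_to d n c -> (0 < n v)%N ->
  legal_move_at N v d d1 -> fires_to d1 (fun u => n u - (u == v))%N c.
Proof.
move=> dc nv [dv rE chE] u; have [rcE chcE] := dc u.
(* The first firing at [v] is the term [j = 0]; turning the rotor once shifts the other terms. *)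
have sentv : sent_to d n v u = ((u == target G (next_rotor N d v)) +
    sent_to d1 (fun u => n u - (u == v)) v u)%N.
  rewrite /sent_to eqxx subn1; case: (n v) nv => // k _.
  rewrite big_ord_recl /= eq_sym.
  congr (_ + _)%N; apply: eq_bigr => j _.
  by rewrite rE ffunE eqxx /next_rotor -!iterS -!iterSr.
have sentN w : w != v ->
    sent_to d n w u = sent_to d1 (fun u => n u - (u == v))%N w u.
  by move=> /negPf wv; rewrite /sent_to rE ffunE wv subn0.
split.
  rewrite rcE rE ffunE; case: eqP => [->|_]; last by rewrite subn0.
  by rewrite subn1 /next_rotor -iterSr prednK.
rewrite chcE chE ffunE (bigD1 v)//= sentv.
rewrite (eq_bigr (fun w => sent_to d1 (fun u => n u - (u == v))%N w u)); last first.
  by move=> w /sentN.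
rewrite [in RHS](bigD1 v)//= -addnA natrD.
rewrite natrB; last by case: eqP => [->|].
by ring.
Qed.

Lemma sum_eq_mem (S : {pred V}) t : (\sum_(v in S) (t == v) = (t \in S))%N.
Proof.
have [tS|tS] := boolP (t \in S).
  by rewrite (bigD1 t)//= eqxx big1// => v /andP[_ /negPf]; rewrite eq_sym => ->.
by rewrite big1// => v vS; case: eqP vS tS => // -> ->.
Qed.

(* Otherwise, by counting the chips on the set [S] of vertices with firings
   left, all remaining firings stay inside [S] and [c] has no chip on [S]; but
   the rotors of [c] in [S] are those of the last firings. *)
Lemma fires_to_legal_at d n c : fires_to d n c -> cycles_occupied c ->
  (exists v, (0 < n v)%N) -> exists2 v, (0 < n v)%N & 1 <= chips d v.
Proof.
move=> dc [c0 cc] [v0 nv0]; apply: contrapT => stuck.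
have d0 v : (0 < n v)%N -> chips d v <= 0.
  move=> nv; rewrite leNgt; apply: contra_notN stuck => dv.
  by exists v => //; rewrite -gtz0_ge1.
pose S := [pred v | (0 < n v)%N].
have tot u : (\sum_(v in S) sent_to d n u v <= n u)%N.
  rewrite /sent_to exchange_big /= -[leqRHS]card_ord -sum1_card.
  by apply: leq_sum => j _; rewrite sum_eq_mem leq_b1.
have sentN u v : u \notin S -> sent_to d n u v = 0.
  by rewrite inE -eqn0Ngt /sent_to => /eqP ->; rewrite big_ord0.
have sumE : \sum_(v in S) chips c v = \sum_(v in S) chips d v
    - (\sum_(u in S) n u)%:R + (\sum_(u in S) \sum_(v in S) sent_to d n u v)%:R.
  rewrite exchange_big /= !natr_sum -sumrN -!big_split /=.
  apply: eq_bigr => v _; have [_ ->] := dc v; congr (_ + _%:R).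
  rewrite (bigID (mem S)) /= [X in (_ + X)%N]big1 ?addn0// => u uS.
  exact: sentN.
have sumd : \sum_(v in S) chips d v <= 0 by apply: sumr_le0 => v; apply: d0.
have sent_le : (\sum_(u in S) \sum_(v in S) sent_to d n u v <= \sum_(u in S) n u)%N.
  by apply: leq_sum.
have sumc0 : 0 <= \sum_(v in S) chips c v by apply: sumr_ge0.
have sentE : (\sum_(u in S) \sum_(v in S) sent_to d n u v = \sum_(u in S) n u)%N.
  apply/eqP; rewrite eqn_leq sent_le /= -(ler_nat int).
  move: sumc0; rewrite sumE -addrA => /le_trans/(_ (lerD sumd (lexx _))).
  by rewrite add0r addrC subr_ge0.
have sumc : \sum_(v in S) chips c v = 0.
  by apply/le_anti; rewrite sumc0 andbT sumE sentE subrK.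
have cS0 v : v \in S -> chips c v = 0.
  by move: v; apply/psumr_eq0P.
have totE u : u \in S -> (\sum_(v in S) sent_to d n u v = n u)%N.
  move=> uS; apply/eqP; rewrite eqn_leq tot /= leqNgt; apply/negP => lt_u.
  suff : (\sum_(u in S) \sum_(v in S) sent_to d n u v < \sum_(u in S) n u)%N.
    by rewrite sentE ltnn.
  rewrite (bigD1 u)//= [ltnRHS](bigD1 u)//= -addSn leq_add//.
  by apply: leq_sum.
have Sclosed u : u \in S -> rotor_succ c u \in S.
  move=> uS; apply: contraT => nS.
  suff : (\sum_(v in S) sent_to d n u v < n u)%N by rewrite totE// ltnn.
  (* The last summand belongs to the last firing at [u], which uses the final rotor [rotor c u] and
     would leave [S]. *)
  have nuE : n u = (n u).-1.+1 by rewrite prednK.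
  rewrite /sent_to exchange_big nuE big_ord_recr /= sum_eq_mem -iterS -nuE.
  have [<- _] := dc u; rewrite (negPf nS) addn0 [ltnRHS]nuE ltnS.
  rewrite -[leqRHS]card_ord -sum1_card.
  by apply: leq_sum => j _; rewrite sum_eq_mem leq_b1.
have iterS k : iter k (rotor_succ c) v0 \in S.
  by elim: k => [//|k IH]; rewrite iterS; apply: Sclosed.
by have [k] := cc v0; rewrite cS0.
Qed.

(** Induction on the total number of firings left: while there are any, one of them is legal. *)
Lemma fires_to_reach d n c :
  fires_to d n c -> cycles_occupied c -> legal_reach N d c.
Proof.
move=> + cc; have [m] := ubnP (\sum_v n v).
elim: m d n => // m IH d n; rewrite ltnS => le_m dc.
have [n0|/existsNP[v0]] := pselect (forall v, n v = 0).
  by rewrite (fires_to0 n0 dc); apply: rt_refl.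
move/eqP; rewrite -lt0n => nv0.
have [v nv dv] := fires_to_legal_at dc cc (ex_intro _ v0 nv0).
have [d1 m1] := legal_move_at_ex N dv.
apply: (@legal_reach_move _ _ _ _ d d1); first by exists v.
apply: IH (fires_to_move dc nv m1); apply: leq_trans le_m.
rewrite (bigD1 v)//= [ltnRHS](bigD1 v)//= eqxx subn1 -addSn prednK// leq_add2l.
by apply: leq_sum => u _; rewrite leq_subr.
Qed.

End Dynamics.

(** * Stationary vectors of strongly connected digraphs *)

Section Stationary.
Context (V E : finType) (G : digraph V E).

(** A left null vector of the Laplacian: with [p v] full rotor turns at each [v], as many chips
    enter a vertex as leave it. *)
Definition stationary (R : pzSemiRingType) (p : V -> R) : Prop :=
  forall v, \sum_(e | target G e == v) p (source G e) = p v * #|Out G v|%:R.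

(** The Laplacian [L] has zero row sums, so it is singular and has a nonzero left null vector. *)
Lemma stationary_rat_ex : (0 < #|V|)%N ->
  exists2 p : V -> rat, stationary p & exists v, p v != 0.
Proof.
move=> V0; pose v_ (i : 'I_#|V|) : V := enum_val i.
pose L : 'M[rat]_#|V| := \matrix_(i, j)
  (\sum_(e in Out G (v_ i)) (target G e == v_ j)%:R - #|Out G (v_ i)|%:R *+ (i == j)).
have L1 : L *m const_mx 1 = 0 :> 'cV_#|V|.
  apply/matrixP => i j; rewrite !mxE.
  under eq_bigr do rewrite !mxE mulr1.
  rewrite sumrB exchange_big /= [X in _ - X](bigD1 i)//= eqxx mulr1n.
  rewrite [X in _ - (_ + X)]big1 ?addr0; last first.
    by move=> k /negPf ki; rewrite eq_sym ki.
  rewrite -sumr_const; apply/eqP; rewrite subr_eq0; apply/eqP.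
  apply: eq_bigr => e _; rewrite (bigD1 (enum_rank (target G e)))//=.
  rewrite /v_ enum_rankK eqxx big1 ?addr0// => k.
  by case: (_ =P enum_val k) => // ->; rewrite enum_valK eqxx.
have /det0P[p p0 pL] : \det L == 0.
  rewrite -det_tr; apply/det0P; exists (const_mx 1).
    apply/eqP => /matrixP/(_ 0 (Ordinal V0)); rewrite !mxE => /eqP.
    by rewrite oner_eq0.
  by apply: trmx_inj; rewrite trmx_mul trmxK trmx_const trmx0.
exists (fun v => p 0 (enum_rank v)) => [v|].
  move/matrixP/(_ 0 (enum_rank v)): pL; rewrite !mxE.
  under eq_bigr do rewrite mxE mulrBr.
  rewrite sumrB [X in _ - X](bigD1 (enum_rank v))//= eqxx mulr1n.
  rewrite [X in _ - (_ + X)]big1 ?addr0; last first.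
    by move=> k /negPf ki; rewrite ki mulr0.
  rewrite /v_ enum_rankK => /eqP; rewrite subr_eq0 => /eqP <-.
  rewrite (partition_big (source G) predT)//= (reindex (@enum_val V predT))/=; last first.
    exact/onW_bij/enum_val_bij.
  apply: eq_bigr => i _; rewrite mulr_sumr.
  rewrite big_mkcond [RHS]big_mkcond /=; apply: eq_bigr => e _.
  rewrite inE andbC; case: eqP => [->|]//=; rewrite enum_valK.
  by case: eqP => _; rewrite ?mulr1 ?mulr0.
move/eqP/rowP: p0 => /existsNP[i /eqP]; rewrite mxE => pi.
by exists (enum_val i); rewrite enum_valK.
Qed.

Lemma sum_source (R : pzSemiRingType) (p : V -> R) :
  \sum_e p (source G e) = \sum_v p v * #|Out G v|%:R.
Proof.
rewrite (partition_big (source G) predT)//=; apply: eq_bigr => v _.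
rewrite (eq_bigr (fun=> p v)); last by move=> e /eqP ->.
rewrite sumr_const mulr_natr; congr (_ *+ _).
by apply: eq_card => e; rewrite !inE.
Qed.

(** By the triangle inequality all defects are nonnegative; they sum to zero, since each edge is
    counted once by target and once by source. *)
Lemma stationary_norm (p : V -> rat) : stationary p -> stationary (fun v => `|p v|).
Proof.
move=> ps v; apply/eqP; rewrite -subr_eq0; apply/eqP.
have ge0 u : predT u ->
    0 <= \sum_(e | target G e == u) `|p (source G e)| - `|p u| * #|Out G u|%:R.
  move=> _; rewrite subr_ge0 -[X in _ * X]ger0_norm ?ler0n// -normrM -ps.
  exact: ler_norm_sum.
apply: (psumr_eq0P ge0) => //; rewrite sumrB -sum_source.
by rewrite (partition_big (target G) predT)//= subrr.
Qed.

(** A zero at the head of an edge forces a zero at its tail, so positivity spreads along paths. *)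
Lemma stationary_gt0 (p : V -> rat) : strongly_connected G -> stationary p ->
  (forall v, 0 <= p v) -> (exists v, p v != 0) -> forall v, 0 < p v.
Proof.
move=> Gsc ps p0 [u pu] v; have /connectP[s + ->] := Gsc u v.
have {pu} : 0 < p u by rewrite lt0r pu p0.
elim: s u => [//|w s IH] u pu /= /andP[/existsP[e /andP[/eqP eu /eqP ew]]].
apply: IH; rewrite lt0r p0 andbT; apply/eqP => pw.
have := ps w; rewrite pw mul0r => /psumr_eq0P/(_ e).
rewrite ew eqxx eu => /(_ _ isT) pu0.
by move: pu; rewrite pu0 ?ltxx.
Qed.

Lemma stationary_nat_ex : (0 < #|V|)%N -> strongly_connected G ->
  exists2 k : V -> nat, stationary k & forall v, (0 < k v)%N.
Proof.
move=> V0 Gsc; have [p /stationary_norm ps [v pv]] := stationary_rat_ex V0.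
have pgt0 : forall v, 0 < `|p v|.
  by apply: stationary_gt0 ps _ _ => //; exists v; rewrite normr_eq0.
(* Denominators are cleared: [k u] is [D] times the absolute value of [p u]. *)
pose D := (\prod_w `|denq (p w)|)%N.
pose k v := (`|numq (p v)| * \prod_(w | w != v) `|denq (p w)|)%N.
have D0 : (0 < D)%N by rewrite prodn_gt0// => w; rewrite absz_gt0 denq_neq0.
have kE u : (k u)%:R = D%:R * `|p u| :> rat.
  rewrite /D (bigD1 u)//= /k !natrM mulrAC; congr (_ * _).
  by rewrite !natr_absz !intr_norm -normrM mulrC -numqE.
exists k => u; last first.
  by rewrite -(ltr_nat rat) kE mulr_gt0// ltr0n.
apply/eqP; rewrite -(eqr_nat rat) natr_sum natrM kE -mulrA natn -ps mulr_sumr.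
by apply/eqP/eq_bigr => e _; rewrite kE.
Qed.

End Stationary.

(** * Recurrent configurations *)

Section RotorPeriod.
Context (T : finType) (s : seq T).
Hypothesis s_uniq : uniq s.

Lemma iter_next_size x k : x \in s -> iter (k * size s) (next s) x = x.
Proof.
move=> xs; elim: k => [//|k IH]; rewrite mulSn iterD IH.
rewrite -(order_cycle (cycle_next s_uniq) s_uniq xs).
by rewrite (iter_order_cycle (cycle_next s_uniq)).
Qed.

Lemma sum_iter_next (F : T -> nat) x k : x \in s ->
  (\sum_(j < k * size s) F (iter j.+1 (next s) x) = k * \sum_(y <- s) F y)%N.
Proof.
move=> xs; elim: k => [|k IH]; first by rewrite big_ord0.
rewrite mulSn big_split_ord /= mulSn -[in RHS]IH; congr (_ + _)%N; last first.
  apply: eq_bigr => j _; rewrite -iterS -addnS addnC iterD.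
  by have := iter_next_size 1 xs; rewrite mul1n => ->.
(* One turn visits the orbit of [next s x], which is a rotation of [s]. *)
have nxs : next s x \in s by rewrite mem_next.
have [i orbE] := orbit_rot_cycle (cycle_next s_uniq) s_uniq nxs.
have /(perm_big _) -> : perm_eq s (orbit (next s) (next s x)).
  by rewrite orbE perm_sym perm_rot.
rewrite /orbit (order_cycle (cycle_next s_uniq) s_uniq nxs).
rewrite (big_nth x) size_traject big_mkord; apply: eq_bigr => j _.
by rewrite (set_nth_default (next s x)) ?size_traject// nth_traject// -iterSr.
Qed.

End RotorPeriod.

Section Recurrence.
Context (V E : finType) (G : digraph V E) (N : rotor_network G).

(** In [k u] full turns [u] uses each of its edges [k u] times; stationarity balances the chips. *)
Lemma fires_to_period (k : V -> nat) (c : config G) : stationary G k ->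
  fires_to N c (fun v => k v * size (rotor_order N v))%N c.
Proof.
have rO u : rotor c u \in rotor_order N u by rewrite mem_rotor_order rotorP.
have szO u : size (rotor_order N u) = #|Out G u|.
  by rewrite -(card_uniqP (rotor_order_uniq N u)); apply/eq_card/mem_rotor_order.
move=> ks v; split; first by rewrite iter_next_size// rotor_order_uniq.
suff -> : (\sum_u sent_to N c (fun v => k v * size (rotor_order N v)) u v =
    k v * size (rotor_order N v))%N by rewrite subrK.
have -> : (k v * size (rotor_order N v) =
    \sum_(e | target G e == v) k (source G e))%N.
  by rewrite szO; have := ks v; rewrite natn => ->.
rewrite [RHS](partition_big (source G) predT)//=; apply: eq_bigr => u _.
rewrite /sent_to (@sum_iter_next _ _ _ (fun e => (target G e == v) : nat))//.
  rewrite big_uniq ?rotor_order_uniq//=.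
  under eq_bigl do rewrite mem_rotor_order.
  rewrite [in LHS]big_distrr /= big_mkcond [RHS]big_mkcond /=.
  apply: eq_bigr => e _; rewrite inE andbC.
  by case: eqP => [->|]//=; case: eqP; rewrite ?muln1 ?muln0.
exact: rotor_order_uniq.
Qed.

(** A move out of [c] begins a period of full turns from [c] to itself; the rest of the period can
    be fired legally and undoes the move. *)
Lemma cycles_occupied_back c d : (0 < #|V|)%N -> strongly_connected G ->
  sinkless G -> legal_reach N c d -> cycles_occupied c -> legal_reach N d c.
Proof.
move=> V0 Gsc Gsl; have [k ks kgt0] := stationary_nat_ex V0 Gsc.
move: c d; apply: legal_reach_ind => [c _|c c1 d m _ IH cc]; first exact: rt_refl.
apply: rt_trans (IH (cycles_occupied_move m cc)) _.
case: (m) => v m1; apply: fires_to_reach cc.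
apply: fires_to_move m1; first exact: fires_to_period ks.
rewrite muln_gt0 kgt0 /=; have /card_gt0P[e] := Gsl v.
by rewrite -(mem_rotor_order N); case: (rotor_order N v).
Qed.

Lemma recurrent_iff_cycles_occupied c :
  (0 < #|V|)%N -> strongly_connected G -> sinkless G ->
  recurrent N c <-> cycles_occupied c.
Proof.
move=> V0 Gsc Gsl; split; first exact: recurrent_cycles_occupied.
move=> cc; split; first exact: cycles_occupied_can_move.
move=> c' d cd c'd; apply: rt_trans c'd _; exact: cycles_occupied_back cc.
Qed.

End Recurrence.

(** * Determinants *)

Lemma det_col_Leibniz (R : comNzRingType) n (F : 'I_n -> 'I_n -> R) :
  \det (\matrix_(i, j) F i j) = \sum_(s : 'S_n) (-1) ^+ s * \prod_j F (s j) j.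
Proof.
rewrite -det_tr; apply: eq_bigr => s _; congr (_ * _).
by apply: eq_bigr => j _; rewrite !mxE.
Qed.

(** * Products of series in separate variables *)

Section UnivariateProducts.
Context (n : nat) (R : comNzRingType).
Implicit Types (m : 'X_{1..n}) (h : nat -> R).

(* The series [\sum_k h k z_i^k]. *)
Definition fps_in_var (i : 'I_n) h : {fps R[n]} :=
  FPSeries (fun m => if m == (U_(i) *+ m i)%MM then h (m i) else 0).

Lemma eq_fps_in_var i h1 h2 : h1 =1 h2 -> fps_in_var i h1 = fps_in_var i h2.
Proof. by move=> h12; apply/fpsP => m /=; rewrite h12. Qed.

Lemma fpcoef_constM c (f : {fps R[n]}) m : fpcoef (fps_const c * f) m = c * fpcoef f m.
Proof.
have m0 : (mdeg (0%MM : 'X_{1..n}) < (mdeg m).+1)%N by rewrite mdeg0.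
rewrite fpcoefM (bigD1 (BMultinom m0)) /=; last by apply/mnm_lepP => j; rewrite mnm0E.
rewrite eqxx subm0 big1 ?addr0// => k /andP[_].
by rewrite -val_eqE /= => /negPf ->; rewrite mul0r.
Qed.

Lemma mnm_mul1E (i j : 'I_n) k : (U_(i) *+ k)%MM j = (if i == j then k else 0)%N.
Proof. by rewrite mulmnE mnm1E; case: eqP => _; rewrite ?mul1n ?mul0n. Qed.

(** As [f] does not involve [z_i], only the split giving all of [z_i] to the first factor
    contributes. *)
Lemma fpcoef_in_varM i h (f : {fps R[n]}) m :
  (forall m', m' i != 0 -> fpcoef f m' = 0) ->
  fpcoef (fps_in_var i h * f) m = h (m i) * fpcoef f (m - U_(i) *+ m i)%MM.
Proof.
move=> f0; have le_m : (U_(i) *+ m i <= m)%MM.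
  by apply/mnm_lepP => j; rewrite mnm_mul1E; case: eqP => // ->.
have lt_m : (mdeg (U_(i) *+ m i)%MM < (mdeg m).+1)%N.
  by rewrite ltnS -[leqRHS](congr1 (@mdeg _) (submK le_m)) mdegD leq_addl.
rewrite fpcoefM (bigD1 (BMultinom lt_m))//= mnm_mul1E !eqxx.
rewrite big1 ?addr0// => k /andP[/mnm_lepP le_k].
rewrite -val_eqE /= => kN; case: eqP => [kE|]; last by rewrite mul0r.
rewrite f0 ?mulr0// mnmBE subn_eq0 -ltnNge ltn_neqAle le_k andbT.
by apply: contra kN => /eqP <-; apply/eqP.
Qed.

(** The Boolean factor, excluding variables outside [s], yields the hypothesis of [fpcoef_in_varM]
    in the induction. *)
Lemma fpcoef_prod_in_var_seq (h : 'I_n -> nat -> R) (s : seq 'I_n) m : uniq s ->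
  fpcoef (\prod_(i <- s) fps_in_var i (h i)) m =
  (\prod_(i <- s) h i (m i)) * [forall i, (i \notin s) ==> (m i == 0)]%:R.
Proof.
elim: s m => [|i s IH] m.
  rewrite !big_nil mul1r fpcoef1; suff -> : (m == 0%MM) = [forall i, m i == 0] by [].
  apply/eqP/forallP => [-> j|m0]; first by rewrite mnm0E.
  by apply/mnmP => j; rewrite mnm0E; apply/eqP/m0.
case/andP=> is_ us; rewrite !big_cons fpcoef_in_varM; last first.
  move=> m' m'i; rewrite IH//; case: forallP => [/(_ i)|]; last by rewrite mulr0.
  by rewrite is_ (negPf m'i).
rewrite IH// mulrA; congr (_ * _ * _).
  rewrite !big_seq; apply: eq_bigr => j js; rewrite mnmBE mnm_mul1E.
  have [ij|_] /= := eqVneq i j; last by rewrite subn0.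
  by rewrite ij js in is_.
congr (nat_of_bool _)%:R; apply: eq_forallb => j; rewrite inE negb_or (eq_sym j).
rewrite mnmBE mnm_mul1E; have [->|_] /= := eqVneq i j; last by rewrite subn0.
by rewrite subnn eqxx implybT.
Qed.

Lemma fpcoef_prod_in_var (h : 'I_n -> nat -> R) m :
  fpcoef (\prod_i fps_in_var i (h i)) m = \prod_i h i (m i).
Proof.
rewrite fpcoef_prod_in_var_seq ?index_enum_uniq//.
by case: forallP => [_|[] i]; rewrite ?mulr1// mem_index_enum.
Qed.

Lemma fpcoef_sum (I : Type) (s : seq I) (P : pred I) (F : I -> {fps R[n]}) m :
  fpcoef (\sum_(i <- s | P i) F i) m = \sum_(i <- s | P i) fpcoef (F i) m.
Proof. exact: (big_morph (fun f => fpcoef f m) (fun f g => fpcoefD f g m)). Qed.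

Lemma fpcoef_sign (b : bool) (f : {fps R[n]}) m :
  fpcoef ((-1) ^+ b * f) m = (-1) ^+ b * fpcoef f m.
Proof. by rewrite !mulr_sign; case: b. Qed.

(** Each Leibniz term is a product of one series per variable, so its coefficient is a product of
    coefficients. *)
Lemma fpcoef_det_in_var (h : 'I_n -> 'I_n -> nat -> R) m :
  fpcoef (\det (\matrix_(i, j) fps_in_var j (h i j))) m =
  \det (\matrix_(i, j) h i j (m j)).
Proof.
rewrite !det_col_Leibniz fpcoef_sum; apply: eq_bigr => s _.
by rewrite fpcoef_sign (fpcoef_prod_in_var (fun j => h (s j) j)).
Qed.

Lemma fps_constM_in_var c i h :
  fps_const c * fps_in_var i h = fps_in_var i (fun k => c * h k).
Proof. by apply/fpsP => m; rewrite fpcoef_constM /=; case: ifP; rewrite ?mulr0. Qed.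

Lemma geometric_in_var i : (1 - fps_var i)^-1 = fps_in_var i (fun=> 1).
Proof. by apply/fpsP => m; rewrite fpcoef_geometric /=; case: ifP. Qed.

Lemma fps_const_in_var c i : fps_const c = fps_in_var i (fun k => c * (k == 0%N)%:R).
Proof.
apply/fpsP => m /=; have [->|m0] := eqVneq m 0%MM.
  by rewrite mnm0E mulm0n !eqxx mulr1.
case: eqP => [mE|//]; have /negPf -> : m i != 0%N.
  by apply: contra m0 => /eqP mi; rewrite mE mi mulm0n.
by rewrite mulr0.
Qed.

Lemma fps_varX_in_var i k : fps_var i ^+ k = fps_in_var i (fun j => (j == k)%:R).
Proof.
elim: k => [|k IH].
  rewrite expr0; apply: etrans (fps_const_in_var 1 i) _.
  by apply: eq_fps_in_var => j; rewrite mul1r.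
rewrite exprS IH; apply/fpsP => m; rewrite fpcoef_varM /=.
case: ifPn => [le_im|nle_im].
  have mi0 : (0 < m i)%N by move/mnm_lepP: le_im => /(_ i); rewrite mnm1E eqxx.
  rewrite mnmBE mnm1E eqxx subn1 -(eqm_add2r U_(i)) submK//.
  rewrite addmC -mulmS prednK//.
  by have -> : (m i == k.+1) = ((m i).-1 == k) by rewrite -{1}(prednK mi0).
case: ifP => // _; case: eqP => // mi; case/negP: nle_im.
by apply/mnm_lepP => j; rewrite mnm1E; case: eqP => [<-|//]; rewrite mi.
Qed.

End UnivariateProducts.

(** * Determinants of functional digraphs *)

Section FunctionalDigraph.
Context (R : comNzRingType) (n : nat) (f : 'I_n -> 'I_n) (S : pred 'I_n).

Definition functional_laplacian : 'M[R]_n :=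
  \matrix_(i, j) ((i == j)%:R - (~~ S j && (i == f j))%:R).

Let reaches j := exists k, S (iter k f j).

(* A permutation other than the identity contributes to the Leibniz formula
   only if its non-fixed points follow [f] and avoid [S]. *)
Lemma det_functional_laplacian1 :
  (forall j, reaches j) -> \det functional_laplacian = 1.
Proof.
move=> reach; rewrite -det_tr /determinant (bigD1 (1%g : 'S_n))//= odd_perm1 mul1r.
rewrite [X in X + _]big1 => [|j _].
  rewrite big1 ?addr0// => s s1.
  have [j sj] : exists j, s j != j.
    apply/existsP; apply: contraNT s1 => /existsPn sid.
    by apply/eqP/permP => j; rewrite perm1; apply/eqP; have := sid j; rewrite negbK.
  have [good|] := boolP [forall i, (s i == i) || ~~ S i && (s i == f i)]; last first.
    move=> /forallPn[i]; rewrite negb_or => /andP[/negPf si /negPf fi].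
    by rewrite (bigD1 i)//= !mxE si fi subrr mul0r mulr0.
  have fs i : s i != i -> ~~ S i /\ f i = s i.
    by have /forallP/(_ i) := good; case: eqP => //= _ /andP[-> /eqP].
  have iters k : iter k f j = iter k s j /\ s (iter k s j) != iter k s j.
    elim: k => [//|k [IH1 IH2]]; split.
      by rewrite !iterS IH1; have [_ ->] := fs _ IH2.
    by rewrite !iterS (inj_eq perm_inj).
  have [k] := reach j; have [-> sk] := iters k.
  by have [/negPf ->] := fs _ sk.
(* The identity contributes 1: a diagonal entry differs from 1 only at a fixed point of [f] outside
   [S], which cannot reach [S]. *)
rewrite !mxE perm1 eqxx; case: (boolP (S j)) => [_|nS] /=; first by rewrite subr0.
case: eqP => [jf|_]; last by rewrite subr0.
have [k] := reach j; suff -> : iter k f j = j by rewrite (negPf nS).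
by elim: k => //= k ->.
Qed.

(* The indicator of the indices that do not reach [S] is a left null vector. *)
Lemma det_functional_laplacian0 j :
  ~ reaches j -> \det functional_laplacian = 0.
Proof.
move=> nreach; pose u : 'rV[R]_n := \row_i (~~ `[< reaches i >])%:R.
have uM : u *m functional_laplacian = 0.
  apply/rowP => i; rewrite !mxE.
  under eq_bigr do rewrite !mxE mulrBr.
  rewrite sumrB (bigD1 i)//= eqxx mulr1 big1 ?addr0; last first.
    by move=> k /negPf ->; rewrite mulr0.
  rewrite (bigD1 (f i))//= eqxx andbT big1 ?addr0; last first.
    by move=> k /negPf ->; rewrite andbF mulr0.
  have [Si|nSi] /= := boolP (S i).
    rewrite mulr0 subr0; suff -> : `[< reaches i >] by [].
    by apply/asboolP; exists 0.
  rewrite mulr1; suff -> : `[< reaches i >] = `[< reaches (f i) >] by rewrite subrr.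
  apply: asbool_equiv_eq; split=> [[[|k]]|[k]].
  - by rewrite /= (negPf nSi).
  - by rewrite iterSr => Sk; exists k.
  - by move=> Sk; exists k.+1; rewrite iterSr.
(* The adjugate turns this into the determinant times [u], and the entry of [u] at [j] is 1; no
   division is involved. *)
have /rowP/(_ j) : u *m functional_laplacian *m \adj functional_laplacian = 0.
  by rewrite uM mul0mx.
rewrite -mulmxA mul_mx_adj mul_mx_scalar !mxE => <-.
by rewrite asboolF// mulr1.
Qed.

Lemma det_functional_laplacian :
  \det functional_laplacian = `[< forall j, reaches j >]%:R.
Proof.
case: asboolP => [/det_functional_laplacian1 //|/existsNP[j]].
exact: det_functional_laplacian0.
Qed.

End FunctionalDigraph.

(** Multilinearity in the columns: [q] selects one summand in each column. *)
Lemma det_col_sum (R : comNzRingType) (n : nat) (I : finType)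
    (P : 'I_n -> pred I) (y : I -> R) (c : 'I_n -> 'I_n -> I -> R) :
  \det (\matrix_(i, j) \sum_(e | P j e) y e * c i j e) =
  \sum_(q in family P) (\prod_j y (q j)) * \det (\matrix_(i, j) c i j (q j)).
Proof.
rewrite det_col_Leibniz.
under [RHS]eq_bigr do rewrite det_col_Leibniz mulr_sumr.
rewrite exchange_big /=; apply: eq_bigr => s _.
rewrite bigA_distr_big_dep mulr_sumr; apply: eq_bigr => q _.
by rewrite big_split /= mulrCA.
Qed.

(** * Coefficients of the determinant *)

Section Coefficients.
Context (V E : finType) (G : digraph V E).
Implicit Types (m : 'X_{1..#|V|}) (q : {ffun 'I_#|V| -> E}).
Local Notation Zy := {mpoly int[#|E|]}.

Definition rotor_index q (i : 'I_#|V|) : 'I_#|V| := enum_rank (target G (q i)).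

Definition reaches_support m q : Prop :=
  forall j, exists k, (0 < m (iter k (rotor_index q) j))%N.

Definition ymon (q : {ffun 'I_#|V| -> E}) : Zy := \prod_i 'X_(enum_rank (q i)).

Definition rotor_family := family (fun i : 'I_#|V| => mem (Out G (enum_val i))).

(** The geometric series puts the diagonal part at every power of [z_j], while the constant
    adjacency part occurs only for [k = 0]. *)
Lemma laplacian_in_var : D_mx G - A_mx G = \matrix_(i, j)
  fps_in_var j (fun k => \sum_(e in Out G (enum_val j)) 'X_(enum_rank e) *
    ((i == j)%:R - ((k == 0%N) && (i == enum_rank (target G e)))%:R)).
Proof.
apply/matrixP => i j; rewrite !mxE.
have sum_const (P : pred E) : \sum_(e | P e) yvar V e =
    fps_const (\sum_(e | P e) ('X_(enum_rank e) : Zy)).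
  apply/fpsP => m; rewrite fpcoef_sum fpcoefC.
  under eq_bigr do rewrite fpcoefC.
  by case: ifP => // _; rewrite big1.
rewrite !sum_const /zvar enum_valK mulrC geometric_in_var fps_constM_in_var.
rewrite (fps_const_in_var _ j); apply/fpsP => m; rewrite fpcoefB.
have coefMn (g : {fps Zy[#|V|]}) b : fpcoef (g *+ (b : bool)) m = fpcoef g m *+ b.
  by case: b.
(* Off the diagonal [D_mx] vanishes, so its series in [z_i] may be read in [z_j]. *)
have swap (F : 'I_#|V| -> Zy) : F i *+ (i == j) = F j *+ (i == j).
  by case: eqP => [->|_].
rewrite coefMn (swap (fun i => fpcoef (fps_in_var i (fun=>
  (\sum_(e in Out G (enum_val i)) 'X_(enum_rank e)) * 1)) m)) /=.
case: ifP => _; last by rewrite mul0rn subr0.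
rewrite (eq_bigr _ (fun e _ => mulrBr _ _ _)) sumrB -mulr_suml mulr1.
congr (_ - _); first by rewrite mulr_natr.
rewrite mulr_suml big_mkcond [RHS]big_mkcond /=.
apply: eq_bigr => e _; rewrite inE.
have -> : (i == enum_rank (target G e)) = (target G e == enum_val i).
  by rewrite -{1}(enum_valK i) (inj_eq enum_rank_inj) eq_sym.
case: (source G e == _) => //=.
by case: (target G e == _); rewrite ?andbT ?andbF ?mulr0.
Qed.

Lemma fpcoef_det_laplacian m : fpcoef (\det (D_mx G - A_mx G)) m =
  \sum_(q in rotor_family) ymon q * `[< reaches_support m q >]%:R.
Proof.
rewrite laplacian_in_var fpcoef_det_in_var.
rewrite (det_col_sum _ (fun e => 'X_(enum_rank e))).
apply: eq_bigr => q _; congr (_ * _).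
rewrite -(det_functional_laplacian _ (rotor_index q) (fun j => 0 < m j)%N).
congr (\det _); apply/matrixP => i j; rewrite !mxE.
by rewrite -eqn0Ngt.
Qed.

Definition rotor_ffun (c : config G) : {ffun 'I_#|V| -> E} :=
  [ffun i => rotor c (enum_val i)].

Lemma rotor_ffun_family c : rotor_ffun c \in rotor_family.
Proof. by apply/familyP => i; rewrite ffunE; exact: rotorP. Qed.

Lemma iter_rotor_index c k i :
  enum_val (iter k (rotor_index (rotor_ffun c)) i) = iter k (rotor_succ c) (enum_val i).
Proof. by elim: k => //= k <-; rewrite /rotor_index ffunE enum_rankK. Qed.

Lemma fpcoef_config c m : (forall v, 0 <= chips c v) ->
  fpcoef (zpow c * yrotor c) m =
  ymon (rotor_ffun c) * [forall v, chips c v == (m (enum_rank v))%:Z]%:R.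
Proof.
move=> c0; rewrite /zpow /yrotor -big_split /=.
rewrite (reindex (@enum_val V predT))/=; last exact/onW_bij/enum_val_bij.
pose h i k := 'X_(enum_rank (rotor_ffun c i)) * (k == `|chips c (enum_val i)|%N)%:R : Zy.
have hE i : zvar E (enum_val i) ^ chips c (enum_val i) * yvar V (rotor c (enum_val i))
    = fps_in_var i (h i).
  rewrite /zvar enum_valK -{1}(gez0_abs (c0 (enum_val i))).
  by rewrite [LHS]mulrC -exprnP fps_varX_in_var /yvar fps_constM_in_var /h ffunE.
under eq_bigr do rewrite hE.
rewrite fpcoef_prod_in_var /h big_split /=; congr (_ * _).
case: forallP => [cm|/forallP/forallPn[v cv]].
  by apply: big1 => i _; rewrite (eqP (cm _)) enum_valK eqxx.
apply/eqP/prodf_eq0; exists (enum_rank v) => //=; rewrite enum_rankK.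
have [mv|//] := eqVneq (m (enum_rank v)) `|chips c v|%N; case/negP: cv.
by rewrite mv gez0_abs.
Qed.

Lemma cycles_occupied_reaches m c :
    (forall v, chips c v = (m (enum_rank v))%:Z) ->
  cycles_occupied c <-> reaches_support m (rotor_ffun c).
Proof.
move=> cm; split=> [[_ cc] j|cc].
  have [k] := cc (enum_val j); rewrite -iter_rotor_index cm enum_valK => mk.
  by exists k.
split=> v; first by rewrite cm.
have [k mk] := cc (enum_rank v); exists k.
by rewrite -(enum_rankK v) -iter_rotor_index cm enum_valK.
Qed.

Lemma config_of_ex m q : q \in rotor_family ->
  exists2 c, (forall v, chips c v = (m (enum_rank v))%:Z) & rotor_ffun c = q.
Proof.
move=> /familyP qO.
have rO : [forall v, [ffun v => q (enum_rank v)] v \in Out G v].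
  by apply/forallP => v; rewrite ffunE; have := qO (enum_rank v); rewrite enum_rankK.
exists (exist _ ([ffun v => (m (enum_rank v))%:Z], [ffun v => q (enum_rank v)]) rO).
  by move=> v; rewrite /chips ffunE.
by apply/ffunP => i; rewrite !ffunE /= enum_valK.
Qed.

End Coefficients.

(** * Comparison of coefficients *)

Theorem theorem7p11 (V E : finType) (G : digraph V E) (N : rotor_network G)
    (V_neq0 : (0 < #|V|)%N) (G_sc : strongly_connected G)
    (N_sinkless : sinkless G) :
  fps_has_sum (recurrent N) (fun c : config G => zpow c * yrotor c)
    (\det (D_mx G - A_mx G)).
Proof.
move=> m.
have rec0 c : recurrent N c -> forall v, 0 <= chips c v.
  by move=> rc v; exact: recurrent_chips_ge0 rc.
pose has_chips (c : config G) := forall v, chips c v = (m (enum_rank v))%:Z.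
pose B : set (config G) := fun c => recurrent N c /\ has_chips c.
pose Q : set {ffun 'I_#|V| -> E} :=
  fun q => q \in rotor_family G /\ reaches_support G m q.
have coefB c : B c -> fpcoef (zpow c * yrotor c) m = ymon (rotor_ffun c).
  move=> [/rec0 c0 cm]; rewrite fpcoef_config//.
  suff -> : [forall v, chips c v == (m (enum_rank v))%:Z] by rewrite mulr1.
  by apply/forallP => v; apply/eqP/cm.
have coefNB c : recurrent N c -> ~ B c -> fpcoef (zpow c * yrotor c) m = 0.
  move=> rc nB; rewrite fpcoef_config; last exact: rec0.
  case: forallP => [cm|_]; last by rewrite mulr0.
  by case: nB; split=> // v; apply/eqP/cm.
(* Recurrent configurations with chip vector [m] correspond to the rotor choices that survive in the
   coefficient of the determinant. *)
have bij : set_bij B Q (@rotor_ffun V E G).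
  split.
  - move=> c [/recurrent_iff_cycles_occupied rc cm].
    split; first exact: rotor_ffun_family.
    by apply/(cycles_occupied_reaches cm)/rc.
  - move=> c d /set_mem[_ cm] /set_mem[_ dm] cd; apply: config_inj.
      by apply/ffunP => v; rewrite cm dm.
    apply/ffunP => v; have /ffunP/(_ (enum_rank v)) := cd.
    by rewrite !ffunE enum_rankK.
  - move=> q [qO qm]; have [c cm cq] := config_of_ex m qO.
    exists c => //; split=> //; apply/recurrent_iff_cycles_occupied => //.
    by apply/(cycles_occupied_reaches cm); rewrite cq.
split.
  (* Nonzero coefficients come only from [B], which is in bijection with a set of rotor choices. *)
  apply: (@sub_finite_set _ _ B).
    by move=> c [rc]; apply: contra_neqP => nB; apply: coefNB.
  by case: bij => _ /inj_card_eq/eq_finite_set <- _; exact: finite_finset.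
rewrite fpcoef_det_laplacian -(fsbig_widen B (recurrent N)) /=; last 2 first.
- by move=> c [].
- by move=> c [rc nB]; exact: coefNB.
rewrite (eq_fsbigr (fun c => ymon (rotor_ffun c))); last first.
  by move=> c /set_mem; exact: coefB.
rewrite -(reindex_fsbig _ _ _ (@ymon V E) bij).
rewrite (eq_fsbigr (fun q => if q \in rotor_family G then
  ymon q * `[< reaches_support G m q >]%:R else 0)); last first.
  by move=> q /set_mem[-> /asboolT ->]; rewrite mulr1.
rewrite (fsbig_fwiden (index_enum _)) ?index_enum_uniq//=.
- by rewrite big_mkcond.
- by move=> q _; exact: mem_index_enum.
- move=> q [_ nQ] /=; case: ifP => // qF; rewrite asboolF ?mulr0//.
  by move=> qm; apply: nQ.
Qed.
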